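(* Let $n$ be sufficiently large. In the $(1:1)$ WMaker--WBreaker Hamilton cycle game on $E(K_n)$ (with WBreaker making the first move), WMaker has a strategy to win in at most $n+6$ moves, i.e. to ensure that after at most $n+6$ of her own moves her claimed edges contain a Hamilton cycle of $K_n$.
   Context: The $(1:1)$ WMaker--WBreaker game on $E(K_n)$: two players, WMaker and WBreaker, alternately claim one edge of the complete graph $K_n$ per turn. Both players are walkers: at her/his first move a player chooses any vertex as starting position; when a player is positioned at a vertex $v$, she/he may only claim an edge incident with $v$ that has not previously been claimed by the opponent, and the other endpoint of the claimed edge becomes her/his new position. Unless stated otherwise WBreaker starts, so a round consists of a move of WBreaker followed by a move of WMaker. In the Hamilton cycle game WMaker wins once her claimed edges contain the edge set of a Hamilton cycle of $K_n$. *)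

(* Defs.v *)
From mathcomp Require Import all_boot.

Set Implicit Arguments.
Unset Strict Implicit.
Unset Printing Implicit Defensive.

(* A move walks from [e.1] to [e.2] and claims the edge between them. At a
   player's first move, [e.1] is the starting vertex she/he chooses. *)
Definition move (n : nat) : predArgType := ('I_n * 'I_n)%type.

Definition edge_of (n : nat) (e : move n) : {set 'I_n} := [set e.1; e.2].

Definition claimed (n : nat) (s : seq (move n)) : seq {set 'I_n} :=
  [seq edge_of e | e <- s].

(* [own] and [opp] are the moves made so far by the player to move and by the
   opponent, in chronological order. Walking back along one's own edges is
   allowed, so a player who has moved legally can always retrace her/his last
   edge; hence for n >= 3 no player is ever left without a legal move. *)
Definition legal (n : nat) (own opp : seq (move n)) (e : move n) : bool :=
  [&& e.1 != e.2,
      (own == [::]) || (e.1 == (last e own).2)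
    & edge_of e \notin claimed opp].

(* The moves of one round: WBreaker's, then WMaker's. *)
Definition round (n : nat) : predArgType := (move n * move n)%type.

Definition wbreaker_moves (n : nat) (h : seq (round n)) : seq (move n) :=
  unzip1 h.

Definition wmaker_moves (n : nat) (h : seq (round n)) : seq (move n) :=
  unzip2 h.

Definition has_hamilton_cycle (n : nat) (E : seq {set 'I_n}) : Prop :=
  exists c : seq 'I_n,
    [/\ 2 < size c,
        ucycle (fun x y => [set x; y] \in E) c
      & forall x : 'I_n, x \in c].

Definition wmaker_won (n : nat) (h : seq (round n)) : Prop :=
  has_hamilton_cycle (claimed (wmaker_moves h)).

(* WMaker's answer to the rounds completed so far and WBreaker's move in the
   current round. *)
Definition strategy (n : nat) : Type := seq (round n) -> move n -> move n.

(* The histories that can arise when WMaker follows [sigma] and WBreaker plays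
   arbitrary legal moves; the game stops once WMaker has won. *)
Inductive play (n : nat) (sigma : strategy n) : seq (round n) -> Prop :=
| play_start : play sigma [::]
| play_round (h : seq (round n)) (b : move n) :
    play sigma h -> ~ wmaker_won h ->
    legal (wbreaker_moves h) (wmaker_moves h) b ->
    play sigma (rcons h (b, sigma h b)).

(* As long as WMaker has not won, she has made fewer than [N] moves and
   [sigma] answers every legal move of WBreaker by a legal move. Since WBreaker
   always has a legal move (n >= 3), every play following [sigma] is won by
   WMaker after at most [N] of her moves. *)
Definition wins_within (n : nat) (sigma : strategy n) (N : nat) : Prop :=
  forall h : seq (round n), play sigma h -> ~ wmaker_won h ->
    size h < N /\
    forall b : move n,
      legal (wbreaker_moves h) (wmaker_moves h) b ->
      legal (wmaker_moves h) (rcons (wbreaker_moves h) b) (sigma h b).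

(* Main.v *)
(* WMaker extends a path from [v0], one new vertex per move, never wasting a move
   until at most two vertices remain unvisited. With [v] her position and [U]
   the unvisited vertices, she keeps all harm done by WBreaker at a single
   vertex [h]: no WBreaker edge lies inside [U], and every [x] in [U] other than
   [h] is free to [v] and to [v0] and is not WBreaker's position. When three
   vertices are left, this lets her step to a vertex whose edge to [v0] WBreaker
   is not in time to claim, so she closes a cycle missing at most two vertices.
   A missing vertex [o] of low WBreaker degree is inserted by jumping to the
   middle [x] of a segment [a x y] of the cycle free to [o], walking to [o], and
   returning to whichever of [a], [y] is still free; WBreaker can only spoil this
   if he stands at [o], and then one more jump makes him leave.
   That the missing vertices have low degree is arranged when 200 vertices are
   left: only boundedly many of them have high degree then, and WBreaker can
   delay the visit to any given vertex by at most nine moves. *)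
Require Import Defs.
From mathcomp Require Import all_boot zify.
From Stdlib Require Import ClassicalEpsilon.

Set Implicit Arguments.
Unset Strict Implicit.
Unset Printing Implicit Defensive.

(** * The game seen through edge sets and positions *)

Section Game.

Variable T : finType.
Implicit Types (M E : rel T) (U Q O : {set T}) (c s : seq T).

Definition add_edge E (x y : T) : rel T :=
  fun a b => [|| E a b, (a == x) && (b == y) | (a == y) && (b == x)].

Definition hamiltonian M :=
  exists c, [/\ 2 < size c, ucycle M c & forall x, x \in c].

(** Only the two edge sets and the two positions matter for the rest of a play, so histories are
    dropped. WBreaker is to move, and [k] bounds WMaker's remaining moves. *)
Fixpoint win k M (w : T) E (b : T) : Prop :=
  hamiltonian M \/
  if k is k'.+1 then
    forall y, y != b -> ~~ M b y ->
      exists u, [/\ u != w, ~~ add_edge E b y w u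
                  & win k' (add_edge M w u) u (add_edge E b y) y]
  else False.

(** WMaker is to move; [k] counts her moves after this one, so [turn k] grants [k.+1] moves in
    all. *)
Definition turn k M (w : T) E (b : T) : Prop :=
  exists u, [/\ u != w, ~~ E w u & win k (add_edge M w u) u E b].

Lemma win_ham k M w E b : hamiltonian M -> win k M w E b.
Proof. by case: k => [|k]; left. Qed.

Lemma win_turn k M w E b :
  (forall y, y != b -> ~~ M b y -> turn k M w (add_edge E b y) y) ->
  win k.+1 M w E b.
Proof. by move=> H; right. Qed.

Lemma winW k M w E b : win k M w E b -> win k.+1 M w E b.
Proof.
elim: k M w E b => [|k IH] M w E b /=; first by case=> // H; left.
case=> [H|H]; [by left|right => y yb My].
by have [u [uw Eu /IH H1]] := H y yb My; exists u.
Qed.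

Lemma leq_win k l M w E b : k <= l -> win k M w E b -> win l M w E b.
Proof.
move=> /subnK <-; elim: (l - k) => // m IH H.
by rewrite addSn; apply/winW/IH.
Qed.

Lemma leq_turn k l M w E b : k <= l -> turn k M w E b -> turn l M w E b.
Proof. by move=> kl [u [H1 H2 /(leq_win kl) H3]]; exists u. Qed.

Lemma add_edge_sym E x y : symmetric E -> symmetric (add_edge E x y).
Proof.
move=> sE a b; rewrite /add_edge sE; congr (_ || _).
by rewrite orbC (andbC (b == y)) (andbC (b == x)).
Qed.

Lemma sub_add_edge E x y : subrel E (add_edge E x y).
Proof. by move=> a b ab; rewrite /add_edge ab. Qed.

Lemma add_edgel E x y : add_edge E x y x y.
Proof. by rewrite /add_edge !eqxx orbT. Qed.

Lemma add_edger E x y : add_edge E x y y x.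
Proof. by rewrite /add_edge !eqxx !orbT. Qed.

Lemma add_edgeN E x y a b : ~~ E a b -> a != x -> b != x -> ~~ add_edge E x y a b.
Proof. by move=> /negPf Eab /negPf ax /negPf bx; rewrite /add_edge Eab ax bx andbF. Qed.

Definition deg E x := #|[set y | E x y]|.

Lemma deg_add_edge E x y a : x != y -> deg (add_edge E x y) a <= deg E a + 1.
Proof.
move=> xy; pose z := if a == x then y else x.
suff /subset_leq_card le : [set b | add_edge E x y a b] \subset z |: [set b | E a b].
  by apply: leq_trans le _; rewrite cardsU1 addnC leq_add2l; case: (_ \in _).
apply/subsetP=> b; rewrite !inE /add_edge /z => /or3P[->|/andP[/eqP-> /eqP->]|/andP[/eqP-> /eqP->]].
- by rewrite orbT.
- by rewrite !eqxx.
by case: (eqVneq y x) => [->|_]; rewrite eqxx.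
Qed.

Lemma sum_deg_add_edge E x y :
  \sum_a deg (add_edge E x y) a <= \sum_a deg E a + 2.
Proof.
have le a : deg (add_edge E x y) a <= deg E a + ((a == x) + (a == y)).
  have /subset_leq_card : [set b | add_edge E x y a b] \subset
      [set b | E a b] :|: ([set b | (a == x) && (b == y)] :|: [set b | (a == y) && (b == x)]).
    by apply/subsetP=> b; rewrite !inE.
  move/leq_trans; apply; apply: leq_trans (leq_card_setU _ _) _.
  rewrite leq_add2l; apply: leq_trans (leq_card_setU _ _) _.
  apply: leq_add; case: (a == _) => /=.
  - by rewrite (_ : [set b | _] = [set y]) ?cards1 //; apply/setP=> b; rewrite !inE.
  - by rewrite (_ : [set b | _] = set0) ?cards0 //; apply/setP=> b; rewrite !inE.
  - by rewrite (_ : [set b | _] = [set x]) ?cards1 //; apply/setP=> b; rewrite !inE.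
  - by rewrite (_ : [set b | _] = set0) ?cards0 //; apply/setP=> b; rewrite !inE.
apply: (@leq_trans (\sum_a (deg E a + ((a == x) + (a == y))))).
  by apply: leq_sum => a _; apply: le.
rewrite big_split leq_add2l big_split /=.
have sum1 (z : T) : \sum_a (a == z : nat) = 1.
  by rewrite (bigD1 z) //= eqxx big1 // => a /negPf->.
by rewrite !sum1.
Qed.

(* [k] rounds are left, and a round raises a degree by at most one. *)
Definition low_degrees Q D E k := forall x, x \notin Q -> deg E x + k <= D.

Lemma low_degrees_add Q D E k x y :
  x != y -> low_degrees Q D E k.+1 -> low_degrees Q D (add_edge E x y) k.
Proof.
move=> xy H a /H; have := deg_add_edge E a xy; lia.
Qed.

Lemma low_degreesW Q D E k l : l <= k -> low_degrees Q D E k -> low_degrees Q D E l.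
Proof. by move=> kl H a /H; apply: leq_trans; rewrite leq_add2l. Qed.

(** * Inserting missing vertices into a cycle *)

Section Insertion.

Variables (Q : {set T}) (D : nat).
Hypothesis cardT : 7 * D + 3 * #|Q| + 6 < #|T|.

(** Counting the excluded starts [x]: at most 2 lie off the cycle, [D + 1] have a successor that is
    [s] or joined to [s] by WBreaker, and for each of the three window vertices at most
    [1 + #|Q| + 2 * D] make it equal to [p], in [Q] or joined to [O]. The total is the left side of
    [cardT]. *)
Lemma free_window E c (s : T) O p :
  uniq c -> #|T| <= size c + 2 -> low_degrees Q D E 0 -> s \notin Q ->
  #|O| <= 2 -> [disjoint O & Q] ->
  exists x, [/\ x \in c, next c x != s, ~~ E s (next c x)
    & forall a, a \in [:: x; next c x; next c (next c x)] ->
        [/\ a \notin Q, a != p & forall o, o \in O -> ~~ E o a]].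
Proof.
move=> uc szc lowE sQ szO OQ.
pose bad := p |: (Q :|: \bigcup_(o in O) [set a | E o a]).
pose bads := s |: [set a | E s a].
have cbads : #|bads| <= D + 1.
  rewrite cardsU1; have := lowE _ sQ; rewrite /deg addn0; case: (_ \notin _); lia.
have cbad : #|bad| <= 1 + (#|Q| + 2 * D).
  rewrite cardsU1; apply: leq_add; first by case: (_ \notin _).
  apply: leq_trans (leq_card_setU _ _) _; rewrite leq_add2l.
  apply: (@leq_trans (\sum_(o in O) D)); last by rewrite sum_nat_const leq_mul2r szO orbT.
  elim/big_rec2: _ => [|o m S oO leS]; first by rewrite cards0.
  apply: leq_trans (leq_card_setU _ _) _; apply: leq_add => //.
  have := lowE o; rewrite addn0; apply.
  by apply: contraTN oO => oQ; rewrite (disjointFl OQ).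
pose f := next c; have injf : injective f := can_inj (prev_next uc).
pose X := [set x | x \notin c] :|: (f @^-1: bads :|: (bad :|: (f @^-1: bad :|: (f \o f) @^-1: bad))).
have cX : #|X| < #|T|.
  have szE := card_uniqP uc.
  have cc : #|[set x | x \notin c]| = #|T| - size c.
    by rewrite -szE -(cardC (mem c)) addKn; apply: eq_card => x; rewrite !inE.
  have leX : #|X| <= #|[set x | x \notin c]| + (#|bads| + (#|bad| + (#|bad| + #|bad|))).
    have ff : #|(f \o f) @^-1: bad| = #|bad| by rewrite card_preimset //; apply: inj_comp.
    rewrite -{3}ff -{2}(card_preimset bad injf) -(card_preimset bads injf).
    do !(apply: leq_trans (leq_card_setU _ _) _; rewrite leq_add2l).
    by [].
  lia.
have [x xX] : exists x, x \notin X.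
  apply/existsP; rewrite -negb_forall; apply: contraTN cX => /forallP H.
  by rewrite -leqNgt -(cardsT T); apply/subset_leq_card/subsetP => x _; apply: H.
move: xX; rewrite !inE !negb_or negbK /= => /and5P[xc /andP[xs Esx] b1 b2 b3].
exists x; split=> // a.
have hb d : ~~ [|| d == p, d \in Q | d \in \bigcup_(o in O) [set a | E o a]] ->
    [/\ d \notin Q, d != p & forall o, o \in O -> ~~ E o d].
  rewrite !negb_or => /and3P[d1 d2 /negP d3]; split=> // o oO; apply/negP => Eod.
  by apply: d3; apply/bigcupP; exists o; rewrite ?inE.
by rewrite !inE => /or3P[]/eqP->; apply: hb; rewrite -?negb_or // !negb_or.
Qed.

(** Rotating the cycle puts the free window in front, so that an insertion only changes a prefix of
    the list. *)
Lemma window M E c (w : T) O p :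
  uniq c -> cycle M c -> #|T| <= size c + 2 -> low_degrees Q D E 0 -> w \notin Q ->
  #|O| <= 2 -> [disjoint O & Q] ->
  exists a x y s, [/\ uniq [:: a, x, y & s], [:: a, x, y & s] =i c,
    cycle M [:: a, x, y & s], x != w /\ ~~ E w x
    & forall d, d \in [:: a; x; y] ->
        [/\ d \notin Q, d != p & forall o, o \in O -> ~~ E o d]].
Proof.
move=> uc Mc szc lowE wQ szO OQ.
have [a [ac aw Ea free]] := free_window p uc szc lowE wQ szO OQ.
have [i s eq_s] := rot_to ac.
have szs : size (rot i c) = size c by rewrite size_rot.
case: s eq_s => [|x [|y s]] eq_s; [move: szs; rewrite eq_s /=; lia.. |].
have us : uniq [:: a, x, y & s] by rewrite -eq_s rot_uniq.
have nx : next c a = x by rewrite -(next_rot i uc) eq_s /= eqxx.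
have ny : next c x = y.
  rewrite -(next_rot i uc) eq_s /= eqxx; case: eqVneq => // xa.
  by move: us; rewrite xa /= mem_head.
move: free aw Ea; rewrite nx ny => free aw Ea.
exists a, x, y, s; split=> //; last by rewrite -eq_s rot_cycle.
by move=> d; rewrite -eq_s mem_rot.
Qed.

(** WMaker goes to [x], to [o], then to [a] or [y]. WBreaker's first reply starts at [b], which is
    neither [o] nor in the window, so it claims no edge from [o] to the window. His second reply is
    a single edge and spoils at most one of the two ways back. *)
Lemma insert M E c (w b o : T) O k :
  symmetric E -> low_degrees Q D E k.+2 -> uniq c -> cycle M c ->
  #|T| <= size c + 2 -> w \notin Q -> #|O| <= 2 -> [disjoint O & Q] ->
  o \in O -> o \notin c -> b != o ->
  (forall M' E' c' w' b', symmetric E' -> low_degrees Q D E' k -> uniq c' ->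
     cycle M' c' -> c' =i o :: c -> w' \notin Q -> win k M' w' E' b') ->
  turn k.+2 M w E b.
Proof.
move=> sE lowE uc Mc szc wQ szO OQ oO oc bo cont.
have [//|a [x [y [s [us eq_c Ms [xw Ex] free]]]]] :=
  window b uc Mc szc (low_degreesW _ lowE) wQ szO OQ.
have freea d : d \in [:: a; x; y] -> [/\ d \notin Q, d != b, d \in c & ~~ E o d].
  move=> dd; have [dQ db /(_ o oO) Eo] := free d dd; split=> //.
  by rewrite -eq_c; move: dd; rewrite !inE => /or3P[]->; rewrite ?orbT.
have [aQ ab ac Ea] := freea a (mem_head _ _).
have xin : x \in [:: a; x; y] by rewrite !inE eqxx orbT.
have yin : y \in [:: a; x; y] by rewrite !inE eqxx !orbT.
have [xQ xb xc Eox] := freea x xin; have [yQ yb yc Eoy] := freea y yin.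
have neqo d : d \in c -> o != d by apply: contraTN => /eqP<-.
have ob : o != b by rewrite eq_sym.
exists x; split=> //; apply: win_turn => p pb _.
have E1 d : d != b -> ~~ E o d -> ~~ add_edge E b p o d by move=> db Eod; apply: add_edgeN.
have sE1 : symmetric (add_edge E b p) := add_edge_sym _ _ sE.
exists o; split; first exact: neqo.
  by rewrite sE1 E1.
apply: win_turn => q qp _.
set E2 := add_edge (add_edge E b p) p q.
have sE2 : symmetric E2 := add_edge_sym _ _ sE1.
have lowE2 : low_degrees Q D E2 k.
  by do 2! (apply: low_degrees_add; first by rewrite eq_sym).
have ax : a != y by move: us; rewrite /= !inE !negb_or => /andP[/and3P[]].
have uo : o \notin [:: a, x, y & s] by rewrite eq_c.
pose M2 := add_edge (add_edge M w x) x o.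
have M2sub : subrel M M2 by move=> u v uv; rewrite /M2 /add_edge uv.
have M2xo : M2 x o := add_edgel _ _ _.
have M2ox : M2 o x := add_edger _ _ _.
have [E2a|E2a] := boolP (E2 o a); last first.
  exists a; split; first by rewrite eq_sym neqo.
    exact: E2a.
  apply: (cont _ _ [:: a, o, x, y & s]) => //.
  - move: us uo; rewrite /= !inE !negb_or.
    by move=> /and4P[/and3P[-> -> ->] /andP[-> ->] -> ->] /and4P[oa -> -> ->]; rewrite eq_sym oa.
  - move: Ms; rewrite /= => /and3P[_ Mxy Mys]; rewrite -/M2.
    rewrite add_edger (sub_add_edge _ _ M2ox) (sub_add_edge _ _ (M2sub _ _ Mxy)) /=.
    by apply: sub_path Mys => u v /M2sub; apply: sub_add_edge.
  - by move=> d; rewrite !inE -eq_c !inE; do 4!case: (d == _) => //=.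
have E2y : ~~ E2 o y.
  apply/negP=> E2y; move: E2a E2y; rewrite {1 2}/E2 {1}/add_edge {2}/add_edge.
  rewrite (negPf (E1 _ ab Ea)) (negPf (E1 _ yb Eoy)) /=.
  move=> /orP[]/andP[/eqP e1 /eqP e2] /orP[]/andP[/eqP e3 /eqP e4]; move: ax;
    by rewrite ?e2 ?e4 -?e1 -?e3 ?eqxx //; subst; rewrite eqxx in qp.
exists y; split; first by rewrite eq_sym neqo.
  exact: E2y.
apply: (cont _ _ [:: a, x, o, y & s]) => //.
- move: us uo; rewrite /= !inE !negb_or.
  move=> /and4P[/and3P[-> -> ->] /andP[-> ->] -> ->] /and4P[oa ox -> ->].
  by rewrite (eq_sym a) (eq_sym x) oa ox.
- move: Ms; rewrite /= => /and3P[Max _ Mys]; rewrite -/M2.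
  rewrite add_edgel (sub_add_edge _ _ M2xo) (sub_add_edge _ _ (M2sub _ _ Max)) /=.
  by apply: sub_path Mys => u v /M2sub; apply: sub_add_edge.
- by move=> d; rewrite !inE -eq_c !inE; do 4!case: (d == _) => //=.
Qed.

Lemma insert_one M E c (w b o : T) :
  symmetric E -> low_degrees Q D E 3 -> uniq c -> cycle M c ->
  (forall x, x \in o :: c) -> w \notin Q -> o \notin Q -> o \notin c ->
  turn 3 M w E b.
Proof.
move=> sE lowE uc Mc allc wQ oQ oc.
have cT : #|T| = (size c).+1.
  have uo : uniq (o :: c) by rewrite /= oc uc.
  rewrite -[RHS]/(size (o :: c)) -(card_uniqP uo).
  by apply: eq_card => x; rewrite allc.
have szc : #|T| <= size c + 2 by rewrite cT; lia.
have szO : #|[set o]| <= 2 by rewrite cards1.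
have OQ : [disjoint [set o] & Q] by rewrite disjoints1.
have oO : o \in [set o] by rewrite inE.
have cont k M' E' c' (w' b' : T) : uniq c' -> cycle M' c' -> c' =i o :: c ->
    win k M' w' E' b'.
  move=> uc' Mc' eqc'; apply: win_ham; exists c'; split; first 2 last.
  - by move=> x; rewrite eqc'.
  - rewrite -(card_uniqP uc') (eq_card (B := T)) => [|x]; last by rewrite eqc' allc.
    by move: cardT; rewrite cT; lia.
  by rewrite /ucycle Mc'.
have [bo|bo] := eqVneq b o; last first.
  apply: leq_turn (leqnSn 2) _.
  apply: (insert sE (low_degreesW _ lowE) uc Mc szc wQ szO OQ oO oc bo) => //.
  by move=> M' E' c' w' b' _ _ uc' Mc' eqc' _; apply: cont uc' Mc' eqc'.
(* WBreaker stands at [o]. A spare jump to [x] makes him leave, and then [insert] applies with his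
   new position [p]; this is the fourth move. *)
have [//|a [x [y [s [us eq_c Ms [xw Ex] free]]]]] :=
  window b uc Mc szc (low_degreesW _ lowE) wQ szO OQ.
exists x; split=> //; apply: win_turn => p pb _.
have xin : x \in [:: a; x; y] by rewrite !inE eqxx orbT.
have [xQ _ _] := free x xin.
apply: (@insert _ _ c x p o [set o] 0) => //.
- exact: add_edge_sym.
- by apply: low_degrees_add lowE; rewrite eq_sym.
- by apply: sub_cycle Mc; apply: sub_add_edge.
- by rewrite -bo.
by move=> M' E' c' w' b' _ _ uc' Mc' eqc' _; apply: cont uc' Mc' eqc'.
Qed.

(** Three moves insert [o1], and four more suffice for [o2] wherever WBreaker then stands. *)
Lemma insert_two M E c (w b o1 o2 : T) :
  symmetric E -> low_degrees Q D E 6 -> uniq c -> cycle M c ->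
  (forall x, x \in [:: o1, o2 & c]) -> w \notin Q ->
  o1 \notin Q -> o2 \notin Q -> uniq [:: o1, o2 & c] -> b != o1 ->
  turn 6 M w E b.
Proof.
move=> sE lowE uc Mc allc wQ oQ1 oQ2 uo bo.
have cT : #|T| = (size c).+2.
  rewrite -[RHS]/(size [:: o1, o2 & c]) -(card_uniqP uo).
  by apply: eq_card => x; rewrite allc.
move: uo; rewrite /= inE negb_or => /and3P[/andP[o12 oc1] oc2 _].
apply: (@insert _ _ c w b o1 [set o1; o2] 4) => //.
- by rewrite cT; lia.
- by rewrite cards2; case: (_ != _).
- by rewrite disjoint_sym disjoints_subset; apply/subsetP=> x xQ; rewrite !inE negb_or;
    apply/andP; split; apply: contraTneq xQ => ->.
- by rewrite !inE eqxx.
move=> M' E' c' w' b' sE' lowE' uc' Mc' eqc' wQ'; apply: win_turn => p pb _.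
apply: (@insert_one _ _ c' _ _ o2) => //.
- exact: add_edge_sym.
- by apply: low_degrees_add lowE'; rewrite eq_sym.
- by move=> x; have := allc x; rewrite !inE eqc' inE orbCA.
by rewrite eqc' inE negb_or eq_sym o12.
Qed.

End Insertion.

End Game.

(** * The path, its closing, and the hot vertex *)

Section Path.

Variables (T : finType) (v0 : T).
Implicit Types (M E : rel T) (U Q : {set T}).

Definition maker_path M (v : T) U :=
  exists s, [/\ path M v0 s, uniq (v0 :: s), last v0 s = v
              & U = [set x | x \notin v0 :: s]].

Lemma maker_path_add M (v : T) U (u : T) :
  maker_path M v U -> u \in U -> maker_path (add_edge M v u) u (U :\ u).
Proof.
move=> [s [Ms us sv ->]] uU; exists (rcons s u).
rewrite last_rcons rcons_path sv add_edgel andbT -rcons_cons rcons_uniq us andbT.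
rewrite inE in uU; split=> //.
  by apply: sub_path Ms; apply: sub_add_edge.
by apply/setP=> x; rewrite !inE mem_rcons inE -!negb_or orbCA.
Qed.

Lemma maker_path_notin M (v : T) U : maker_path M v U -> (v \notin U) && (v0 \notin U).
Proof.
by move=> [s [_ _ <- ->]]; rewrite inE negbK mem_last inE negbK mem_head.
Qed.

(** WMaker closes the cycle by walking to [v0] and steps straight back to [a]: insertions must start
    outside [Q], and nothing is known about the degree of [v0]. Her own edge cannot be claimed by
    WBreaker, so the way back is open. *)
Lemma close_turn Q D M E (a b : T) U k :
  7 * D + 3 * #|Q| + 6 < #|T| -> symmetric E -> low_degrees Q D E k.+2 ->
  maker_path M a U -> ~~ E a v0 -> a \notin Q -> [disjoint U & Q] ->
  0 < #|U| <= 2 -> 3 * #|U| <= k -> turn k.+2 M a E b.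
Proof.
move=> cT sE lowE [s [Ms us sa eqU]] Ea aQ UQ szU kU.
have sT : #|T| = #|U| + size (v0 :: s).
  rewrite -(card_uniqP us) -(cardC (mem (v0 :: s))) addnC; congr (_ + _).
  by rewrite eqU; apply: eq_card => x; rewrite !inE.
have av0 : v0 != a.
  case: s sa us sT {Ms eqU} => [|x s] sa us sT.
    by move: sT cT szU => /=; lia.
  by rewrite -sa; apply: contraTneq us => -> /=; rewrite mem_last.
exists v0; split=> //; apply: win_turn => y yb My.
have yb' : b != y by rewrite eq_sym.
exists a; split; first by rewrite eq_sym.
  rewrite /add_edge sE (negPf Ea) /=; apply/negP.
  by case/orP=> /andP[/eqP eb /eqP ey]; move: My; rewrite -eb -ey /add_edge !eqxx ?orbT.
apply: win_turn => z zy _.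
have zy' : y != z by rewrite eq_sym.
set M2 := add_edge _ v0 a; set E2 := add_edge _ y z.
have sE2 : symmetric E2 by do 2! apply: add_edge_sym.
have lowE2 : low_degrees Q D E2 k by do 2! apply: low_degrees_add => //.
have subM : subrel M M2 by move=> p q pq; rewrite /M2 /add_edge pq.
have cM2 : cycle M2 (v0 :: s).
  by rewrite /= rcons_path (sub_path subM Ms) sa /M2 add_edger.
have UQ' o : o \in U -> o \notin Q by move=> oU; rewrite (disjointFr UQ).
have inU x : (x \in U) || (x \in v0 :: s) by rewrite eqU inE orNb.
have outU x : x \in U -> x \notin v0 :: s by rewrite eqU inE.
have [U1|U2] : #|U| = 1 \/ #|U| = 2 by clear -szU; lia.
  have /cards1P[o eo] := introT eqP U1.
  have oU : o \in U by rewrite eo inE.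
  rewrite U1 in kU; apply: (@leq_turn _ 3) => //.
  apply: (insert_one cT z sE2 _ us cM2 _ aQ (UQ' _ oU) (outU _ oU)).
    exact: low_degreesW kU lowE2.
  by move=> x; have := inU x; rewrite eo inE inE.
have /cards2P[o1 [o2 [o12 eo]]] := introT eqP U2.
have oU1 : o1 \in U by rewrite eo !inE eqxx.
have oU2 : o2 \in U by rewrite eo !inE eqxx orbT.
rewrite U2 in kU; apply: (@leq_turn _ 6) => //.
have lowE6 : low_degrees Q D E2 6 := low_degreesW kU lowE2.
(* WBreaker occupies at most one missing vertex; one that he does not occupy is inserted first. *)
have [zo|zo] := eqVneq z o1; last first.
  apply: (insert_two cT sE2 lowE6 us cM2 _ aQ (UQ' _ oU1) (UQ' _ oU2) _ zo).
    by move=> x; have := inU x; rewrite eo !inE; case: (x == o1); rewrite ?orbT.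
  by rewrite cons_uniq inE negb_or o12 cons_uniq us !outU.
apply: (insert_two cT sE2 lowE6 us cM2 _ aQ (UQ' _ oU2) (UQ' _ oU1)).
- by move=> x; have := inU x; rewrite eo !inE; case: (x == o1); rewrite ?orbT.
- by rewrite cons_uniq inE negb_or eq_sym o12 cons_uniq us !outU.
by rewrite zo.
Qed.

(** WBreaker is to move. If [h] is outside [U], all of [U] is unharmed. By [hot_inner], the only
    WBreaker edge that can lead from WMaker's next vertex into the rest of [U] is the one he is
    about to claim. *)
Record hot E (v b : T) U (h : T) : Prop := Hot {
  hot_sym : symmetric E;
  hot_v0 : v0 \notin U;
  hot_v : v \notin U;
  hot_neq : v != v0;
  hot_inner : {in U &, forall x y, E x y = false};
  hot_clean : {in U, forall x, x != h -> [/\ E v x = false, E v0 x = false & x != b]};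
  hot_h : h \in U -> ~~ (E v h && E v0 h) }.

(* An upper bound for the number of moves after which WMaker has visited [z];
   the values come from listing how WBreaker can shield [z] from her. *)
Definition delay E (v b : T) U (h z : T) :=
  if z == h then
    if E v h then if b == v then 6 else if b == h then 7 else 4
    else if b == v then 3 else if b == h then 2 else 1
  else if h \notin U then 3
  else if E v h then if b == h then 4 else 3
  else if E v0 h then if b == h then 8 else 9
  else if b == h then 5 else 3.

Lemma hot_next E (v p : T) U (h y u h' : T) :
  hot E v p U h -> y != p -> u \in U ->
  (p \in U -> p != u -> y \in U -> y != u -> False) ->
  (y \in U -> y != u -> y = h') ->
  (p \in U -> p != u -> u = y \/ y = v0 -> p = h') ->
  (h \in U -> h != u -> E v0 h -> h = h') ->
  (h' \in U -> h' != u -> (u = p /\ h' = y) \/ (u = y /\ h' = p) ->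
     ~~ E v0 h' /\ p != v0 /\ y != v0) ->
  hot (add_edge E p y) u y (U :\ u) h'.
Proof.
move=> [sE v0U vU vv0 inn cl hh] yp uU C1 C4 C2 C3 C5.
have uv0 : u != v0 by apply: contraTneq uU => ->.
split=> //.
- exact: add_edge_sym.
- by rewrite !inE negb_and v0U orbT.
- by rewrite !inE eqxx.
- move=> x z xU zU; have [/setD1P[xu xU'] /setD1P[zu zU']] := (xU, zU).
  rewrite /add_edge inn //=; apply/negbTE/negP => /orP[]/andP[/eqP ex /eqP ez]; subst.
    exact: C1.
  exact: C1.
- move=> x xU xh'; have /setD1P[xu xU'] := xU.
  have xy : x != y by apply: contra_neq xh' => xy; rewrite xy; apply: C4; rewrite -xy.
  have xv0 : x != v0 by apply: contraTneq xU' => ->.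
  split=> //; rewrite /add_edge (negPf xy) andbF /=.
    rewrite inn //=; apply/negbTE/negP => /andP[/eqP uy /eqP xp].
    by subst; move: xh'; rewrite -C2 ?eqxx //; left.
  apply/negbTE; rewrite negb_or; apply/andP; split; last first.
    apply/negP => /andP[/eqP vy /eqP xp]; subst.
    by move: xh'; rewrite -C2 ?eqxx //; right.
  have [xh|xh] := eqVneq x h; last by have [_ -> _] := cl x xU' xh.
  by apply/negP => Eh; subst; move: xh'; rewrite -C3 ?eqxx.
move=> hU; have /setD1P[hu hU'] := hU.
rewrite negb_and -implybE; apply/implyP.
rewrite {1}/add_edge inn //= => H.
have [|Eh [pv yv]] := C5 hU' hu.
  by case/orP: H => /andP[/eqP-> /eqP->]; auto.
by rewrite /add_edge (negPf Eh) /= !(eq_sym v0) (negPf pv) (negPf yv).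
Qed.

Ltac boolean_eqs :=
  repeat match goal with
  | H : _ /\ _ |- _ => destruct H
  | H : is_true (_ && _) |- _ => case/andP: H => ? ?
  | H : (_ && _) = true |- _ => case/andP: H => ? ?
  | H : is_true (_ || _) |- _ => case/orP: H => ?
  | H : (_ || _) = true |- _ => case/orP: H => ?
  | H : (_ && _) = false |- _ => case/nandP: (negbT H) => {H} H
  | H : (_ || _) = false |- _ => case/norP: (negbT H) => {H} ? ?
  | H : ~~ _ = false |- _ => apply negbFE in H
  | H : is_true (~~ (_ == _)) |- _ => apply (elimN eqP) in H
  | H : is_true (_ == _) |- _ => apply (elimT eqP) in H
  | H : (_ == _) = true |- _ => apply (elimT eqP) in H
  | H : (_ == _) = false |- _ => apply (elimF eqP) in H
  | H : ~~ (_ == _) = true |- _ => apply (elimN eqP) in H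
  | H : is_true (~~ _) |- _ => apply negbTE in H
  | H : ~~ _ = true |- _ => apply negbTE in H
  | H : _ \/ _ |- _ => destruct H
  end; unfold is_true in *; subst.

Ltac hot_cases :=
  intros; boolean_eqs;
  repeat match goal with |- _ /\ _ => split end;
  try match goal with
  | |- ~~ (_ == _) = true => apply/eqP => ?
  | |- ~~ ?b = true => apply: negbT
  end; subst; congruence.

(** Branches of [delay] that contradict the current case are discarded, so that only comparisons of
    numerals remain. *)
Ltac decide_ifs :=
  repeat match goal with
  | |- context [if ?b then _ else _] =>
      let e := fresh "e" in destruct b eqn:e; try solve [exfalso; hot_cases]
  end.

Ltac edge_free :=
  apply/negbTE/negP => ?; hot_cases.

(** WMaker visits the target [z] whenever she can reach it and the harm stays at one vertex.
    Otherwise she moves to [h], to [y] or to a neutral vertex [u], and the delay drops. *)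
Lemma hot_step E (v p : T) U (h z y : T) :
  hot E v p U h -> 2 < #|U| -> z \in U -> y != p ->
  exists u h', [/\ u \in U, ~~ add_edge E p y v u,
    hot (add_edge E p y) u y (U :\ u) h'
    & z \in U :\ u -> delay (add_edge E p y) u y (U :\ u) h' z < delay E v p U h z].
Proof.
move=> Hh szU zU yp; have [sE v0U vU vv0 inn cl hh] := Hh.
have pU : p \in U = false \/ p = h.
  have [pU|/negbTE] := boolP (p \in U); [right|by left].
  by apply/eqP/negPn/negP => /(cl p pU)[_ _]; rewrite eqxx.
have adE a b : a \in U -> b \in U ->
    add_edge E p y a b = (a == p) && (b == y) || (a == y) && (b == p).
  by move=> aU bU; rewrite /add_edge inn.
have adv a : a \in U -> add_edge E p y v a = E v a || (v == p) && (a == y) || (v == y) && (a == p).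
  by move=> aU; rewrite /add_edge orbA.
have ad0 a : a \in U -> add_edge E p y v0 a = E v0 a || (v0 == p) && (a == y) || (v0 == y) && (a == p).
  by move=> aU; rewrite /add_edge orbA.
have clh a : a \in U -> a != h -> E v a = false /\ E v0 a = false.
  by move=> aU /(cl a aU)[].
(* The neutral vertex: three unvisited vertices guarantee one other than [h] and [y], and it is free
   to [v]. *)
have [u [uU uh uy]] : exists u, [/\ u \in U, u != h & u != y].
  have /card_gt0P[u] : 0 < #|U :\: [set h; y]|.
    rewrite cardsD subn_gt0; apply: leq_ltn_trans (subset_leq_card (subsetIr _ _)) _.
    by apply: leq_ltn_trans szU; rewrite cards2; case: (_ != _).
  by rewrite !inE negb_or => /andP[/andP[uh uy] uU]; exists u.
have [Evu Ev0u] := clh u uU uh.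
have [_ _ up] := cl u uU uh.
have Eu : ~~ add_edge E p y v u by rewrite adv // Evu (negPf uy) (negPf up) !andbF.
have capt (x h' : T) : x = z -> z \in U :\ x ->
    delay (add_edge E p y) x y (U :\ x) h' z < delay E v p U h z.
  by move=> ->; rewrite !inE eqxx.
clear szU cl.
have [zh|zh] := eqVneq z h.
- subst h; have [Evz|Evz] := boolP (E v z).
  + have Ev0z : E v0 z = false by have := hh zU; rewrite Evz => /negbTE.
    have adz : add_edge E p y u z = false by rewrite adE // (negPf up) (negPf uy).
    case pv: (p == v).
      case yz: ((y \in U) && (y != z)).
        (* WBreaker's new vertex becomes the hot one; [z] is clean again, since only its edge to the
           abandoned [v] was claimed. *)
        have /andP[yU yz'] := yz; have [Evy Ev0y] := clh y yU yz'.
        exists u, y; split=> //; first by apply: (hot_next Hh yp uU); hot_cases.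
        have ad0y : add_edge E p y v0 y = false by rewrite ad0 //; edge_free.
        have aduy : add_edge E p y u y = false by rewrite adE //; edge_free.
        by move=> _; rewrite /delay; decide_ifs.
      exists u, z; split=> //; first by apply: (hot_next Hh yp uU); hot_cases.
      by move=> _; rewrite /delay; decide_ifs.
    case yz: ((y \in U) && (y != z)).
      (* WBreaker's new vertex would be a second harmed one, so WMaker visits it. *)
      have /andP[yU yz'] := yz; have [Evy Ev0y] := clh y yU yz'.
      exists y, z; split=> //; first by rewrite adv //; apply: negbT; edge_free.
        by apply: (hot_next Hh yp yU); hot_cases.
      have := adE y z yU zU; rewrite eqxx (negPf yp) /=; case zp: (z == p) => adyz.
        by move=> _; rewrite /delay; decide_ifs.
      by move=> _; rewrite /delay; decide_ifs.
    exists u, z; split=> //; first by apply: (hot_next Hh yp uU); hot_cases.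
    by move=> _; rewrite /delay; decide_ifs.
  + have [adz|adz] := boolP (add_edge E p y v z); last first.
      exists z, y; split=> //; last exact: capt.
      case yz: ((y \in U) && (y != z)); last by apply: (hot_next Hh yp zU); hot_cases.
      have /andP[yU yz'] := yz; have [Evy Ev0y] := clh y yU yz'.
      by apply: (hot_next Hh yp zU); hot_cases.
    have aduz : add_edge E p y u z = false by rewrite adE //; edge_free.
    exists u, z; move: adz; rewrite adv // (negPf Evz) /= => adz.
    split=> //; first by apply: (hot_next Hh yp uU); case/orP: adz; hot_cases.
    by move=> _; rewrite /delay; case/orP: adz => ?; decide_ifs.
have [Evz Ev0z] := clh z zU zh.
(* WBreaker did not stand at the clean vertex [z], so he can block it only by walking from [v] to
   [z]. *)
case pvyz: ((p == v) && (y == z)).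
  have /andP[/eqP pv /eqP yz] := pvyz; subst p y.
  case hE: ((h \in U) && ~~ E v h).
    have /andP[hU /negbTE Evh] := hE.
    have adhz : add_edge E v z h z = false by rewrite adE //; edge_free.
    exists h, z; split=> //; first by rewrite adv //; apply: negbT; edge_free.
      by apply: (hot_next Hh yp hU); hot_cases.
    by move=> _; rewrite /delay; decide_ifs.
  have aduz : add_edge E v z u z = false by rewrite adE //; edge_free.
  exists u, z; split=> //.
    case hU: (h \in U); last by apply: (hot_next Hh yp uU); hot_cases.
    have Ev0h : E v0 h = false.
      by move: hE (hh hU); rewrite hU /= => /negbFE -> /negbTE.
    by apply: (hot_next Hh yp uU); hot_cases.
  by move=> _; rewrite /delay; decide_ifs.
have adz : ~~ add_edge E p y v z by rewrite adv //; apply: negbT; edge_free.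
have [yU|yU] := boolP (y \in U); last first.
  exists z, h; split=> //; last exact: capt.
  by apply: (hot_next Hh yp zU); hot_cases.
have [yh|yh] := eqVneq y h.
  exists z, h; split=> //; last exact: capt.
  by apply: (hot_next Hh yp zU); hot_cases.
have [Evy Ev0y] := clh y yU yh.
have [yz|yz] := eqVneq y z.
  (* Here a visit to [z] would leave [h] cut off from both ends of the path, so [h] comes first. *)
  case hE: [&& p == h, h \in U & E v0 h].
    have /and3P[/eqP ph hU Ev0h] := hE.
    have Evh : E v h = false by have := hh hU; rewrite Ev0h andbT => /negbTE.
    exists h, z; split=> //; first by rewrite adv //; apply: negbT; edge_free.
      by apply: (hot_next Hh yp hU); hot_cases.
    by move=> _; rewrite /delay; decide_ifs.
  exists z, h; split=> //; last exact: capt.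
  by apply: (hot_next Hh yp zU); hot_cases.
(* If [p] is [h], the edge [h y] would stay inside the unvisited set; if [v0 h] is claimed, both [h]
   and [y] would be harmed. So one of them is visited before [z]. *)
case hE: ((h \in U) && ((p == h) || E v0 h)); last first.
  exists z, y; split=> //; last exact: capt.
  by apply: (hot_next Hh yp zU); hot_cases.
have /andP[hU hE'] := hE.
have [Evh|Evh] := boolP (E v h).
  have Ev0h : E v0 h = false by have := hh hU; rewrite Evh => /negbTE.
  move: hE'; rewrite Ev0h orbF => /eqP ph.
  have adyh : add_edge E p y y h by rewrite ph add_edger.
  exists y, h; split=> //; first by rewrite adv //; apply: negbT; edge_free.
    by apply: (hot_next Hh yp yU); hot_cases.
  by move=> _; rewrite /delay; decide_ifs.
exists h, y; split=> //; first by rewrite adv //; apply: negbT; edge_free.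
  by apply: (hot_next Hh yp hU); hot_cases.
have adhy : add_edge E p y h y = (h == p) by rewrite adE // eqxx andbT (eq_sym h y) (negPf yh) orbF.
move=> _; case hp: (h == p); rewrite hp in adhy.
  by rewrite /delay; decide_ifs.
by rewrite /delay; decide_ifs.
Qed.

End Path.

(** * Visiting prescribed vertices and the last three vertices *)

Section Phases.

Variables (T : finType) (v0 : T).
Implicit Types (M E : rel T) (U Q : {set T}).

(** The budget: [#|U| - 2] moves extend the path, 2 close it and step back, and 7 insert two
    vertices. [inv] bounds WBreaker's edges in terms of the rounds still to come. *)
Definition winning (inv : rel T -> nat -> Prop) E (v b : T) U :=
  forall M, maker_path v0 M v U -> inv E (#|U| + 7) -> win (#|U| + 7) M v E b.

Lemma delay_bounds E (v b : T) U (h z : T) : 0 < delay v0 E v b U h z <= 9.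
Proof. by rewrite /delay; do ![case: ifP => _]. Qed.

Section Shrinking.

Variable inv : rel T -> nat -> Prop.
Hypothesis inv_add : forall E x y k, x != y -> inv E k.+1 -> inv (add_edge E x y) k.

Lemma winning_step E (v b : T) U :
  (forall y, y != b -> exists u, [/\ u \in U, ~~ add_edge E b y v u
    & winning inv (add_edge E b y) u y (U :\ u)]) ->
  winning inv E v b U.
Proof.
move=> H M pM; rewrite addnS => invE; apply: win_turn => y yb _.
have [u [uU Eu W]] := H y yb; exists u; split=> //.
  by apply: contraTneq uU => ->; have /andP[] := maker_path_notin pM.
have -> : #|U| + 6 = #|U :\ u| + 7 by rewrite (cardsD1 u U) uU !addnS.
apply: W; first exact: maker_path_add.
have -> : #|U :\ u| + 7 = #|U| + 6 by rewrite (cardsD1 u U) uU !addnS.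
by apply: inv_add => //; rewrite eq_sym.
Qed.

(** A target in [Q] is kept until visited, its delay falling with each move; every later target is
    granted 10 moves, above the largest delay. Delays are positive, so no vertex of [Q] is left when
    [m] vertices remain. After [Q] is exhausted, any unvisited vertex serves as target. *)
Lemma hunt Q m :
  2 <= m ->
  (forall E (v b : T) U h, hot v0 E v b U h -> #|U| = m -> [disjoint U & Q] ->
     winning inv E v b U) ->
  forall E (v b : T) U h, hot v0 E v b U h -> m <= #|U| ->
    (forall z, z \in U :&: Q -> exists2 z, z \in U :&: Q
       & delay v0 E v b U h z + 10 * #|U :&: Q|.-1 + m <= #|U|) ->
  winning inv E v b U.
Proof.
move=> m2 cont E v b U h; move: {2}#|U| (erefl #|U|) => n.
elim: n E v b U h => [|n IH] E v b U h Un Hh mU targets; first by move: mU; rewrite Un; lia.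
have [Um|Um] := eqVneq #|U| m.
  apply: (cont _ _ _ _ h) => //; rewrite -setI_eq0; apply/set0Pn => -[z /targets[z' _]].
  by have := delay_bounds E v b U h z'; rewrite Um; lia.
have szU : 2 < #|U| by lia.
have [z zU Hz] : exists2 z, z \in U & (forall x, x \in U :&: Q -> z \in U :&: Q /\
    delay v0 E v b U h z + 10 * #|U :&: Q|.-1 + m <= #|U|).
  have [UQ|[x xUQ]] := set_0Vmem (U :&: Q).
    have /card_gt0P[z zU] : 0 < #|U| by lia.
    by exists z => // x; rewrite UQ inE.
  have [z zUQ Hz] := targets x xUQ; exists z => //.
  by move: zUQ; rewrite inE => /andP[].
apply: winning_step => y yb.
have [u [h' [uU Eu Hh' less]]] := hot_step Hh szU zU yb.
exists u; split=> //.
have Uu : #|U| = #|U :\ u|.+1 by rewrite (cardsD1 u U) uU.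
apply: (IH _ _ _ _ h') => //; [lia|lia|].
move=> x xUQ.
have UuQ : (U :\ u) :&: Q = (U :&: Q) :\ u by apply/setP=> w; rewrite !inE andbA.
have xU : x \in U :&: Q by move: xUQ; rewrite UuQ => /setD1P[].
have [zUQ bound] := Hz x xU.
have cUQ := cardsD1 u (U :&: Q).
have [zu|zu] := eqVneq u z.
  exists x => //; rewrite UuQ in xUQ *.
  have : 0 < #|(U :&: Q) :\ u| by apply/card_gt0P; exists x.
  rewrite zu zUQ in cUQ; rewrite zu in Uu *.
  have := delay_bounds (add_edge E b y) z y (U :\ z) h' x.
  have := delay_bounds E v b U h z.
  move: cUQ bound Uu; clear; lia.
have zUu : z \in U :\ u by rewrite !inE eq_sym zu.
exists z; first by rewrite UuQ !inE eq_sym zu -in_setI.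
rewrite UuQ; have := less zUu; move: cUQ bound Uu; clear; case: (u \in _) => /=; lia.
Qed.

End Shrinking.

Lemma card_setD1 U (x : T) k : x \in U -> #|U| = k.+1 -> #|U :\ x| = k.
Proof. by move=> xU; rewrite (cardsD1 x) xU => -[]. Qed.

(** WMaker needs a vertex whose edge to [v0] survives WBreaker's next move. He can claim such an
    edge only when standing at one of its ends. *)
Lemma endgame Q D E (v b : T) U h :
  7 * D + 3 * #|Q| + 6 < #|T| -> hot v0 E v b U h -> #|U| = 3 -> [disjoint U & Q] ->
  winning (low_degrees Q D) E v b U.
Proof.
move=> cT [sE v0U vU vv0 inn cl hh] U3 UQ M pM.
rewrite U3 => lowE; apply: win_turn => y yb _.
have by' : b != y by rewrite eq_sym.
have lowE1 := low_degrees_add by' lowE; set E1 := add_edge E b y in lowE1 *.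
have sE1 : symmetric E1 := add_edge_sym _ _ sE.
have UQ' o : o \in U -> o \notin Q by move=> oU; rewrite (disjointFr UQ).
have neq0 x : x \in U -> v0 != x by move=> xU; apply: contraTneq xU => <-.
have neqv x : x \in U -> x != v by move=> xU; apply: contraTneq xU => ->.
have subQ x : [disjoint U :\ x & Q] := disjointWl (subsetDl _ _) UQ.
have cU x : x \in U -> #|U :\ x| = 2.
  by move=> xU; apply: card_setD1.
have free x : x \in U -> x != h -> x != y -> ~~ E1 v x.
  move=> xU xh xy; have [Ev _ xb] := cl x xU xh.
  by rewrite /E1 /add_edge Ev (negPf xb) (negPf xy) !andbF.
have close a E2 z : a \in U -> ~~ E2 v0 a -> symmetric E2 -> low_degrees Q D E2 8 ->
    turn 8 (add_edge M v a) a E2 z.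
  move=> aU Ea sE2 lowE2; apply: (@close_turn _ v0 Q D _ _ _ _ (U :\ a) 6) => //.
  - exact: maker_path_add.
  - by rewrite sE2.
  - exact: UQ'.
  - by rewrite cU.
  by rewrite cU.
have [yv0|yv0] := eqVneq y v0; last first.
  have [a [aU ah ay]] : exists a : T, [/\ a \in U, a != h & a != y].
    have /card_gt0P[u] : 0 < #|U :\: [set h; y]|.
      rewrite cardsD U3 subn_gt0; apply: leq_ltn_trans (subset_leq_card (subsetIr _ _)) _.
      by rewrite cards2; case: (_ != _).
    by rewrite !inE negb_or => /andP[/andP[uh uy] uU]; exists u.
  have [_ Ev0a ab] := cl a aU ah.
  exists a; split; [exact: neqv|exact: free|apply: win_turn => z zy _].
  have yz : y != z by rewrite eq_sym.
  apply: close => //; last exact: low_degrees_add.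
    rewrite /add_edge /E1 /add_edge Ev0a !(eq_sym v0) (negPf yv0) (negPf ay) (negPf ab).
    by rewrite !andbF.
  exact: add_edge_sym.
subst y.
(* WBreaker stands at [v0], so two clean vertices are prepared: he can claim only one of their edges
   to [v0] at once. *)
have [a [c [aU cU' ah ch ac]]] : exists a c : T, [/\ a \in U, c \in U, a != h, c != h & a != c].
  have /card_gt1P[a [c []]] : 1 < #|U :\ h|.
    by have := cardsD1 h U; rewrite U3; case: (h \in U) => /=; lia.
  by move=> /setD1P[ah aU] /setD1P[ch cU'] ac; exists a, c.
have [_ Ev0a ab] := cl a aU ah; have [_ Ev0c cb] := cl c cU' ch.
have neqy x : x \in U -> x != v0 by move=> xU; rewrite eq_sym neq0.
exists a; split; [exact: neqv|by apply: free => //; apply: neqy|apply: win_turn => z zv0 _].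
have v0z : v0 != z by rewrite eq_sym.
have lowE2 := low_degrees_add v0z lowE1; set E2 := add_edge E1 v0 z in lowE2 *.
have sE2 : symmetric E2 := add_edge_sym _ _ sE1.
have E1f x : x \in U -> x != b -> E v0 x = false -> E1 v0 x = false.
  move=> xU xb Ex; rewrite /E1 /add_edge Ex (negPf xb) andbF /= (eq_sym v0) (negPf by').
  by [].
have [za|za] := eqVneq a z; last first.
  apply: close => //; rewrite /E2 /add_edge E1f // (negPf za) andbF /=.
  by rewrite (negPf v0z).
(* Having claimed [v0 a], WBreaker stands at [a] and is too late for [v0 c]. The step to [c] also
   leaves only one vertex missing, which pays for the extra move. *)
subst z; exists c; split; first by rewrite eq_sym.
  rewrite /E2 /E1 /add_edge inn // (negPf (neqy _ aU)) (negPf (neqy _ cU')) !andbF.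
  by [].
apply: win_turn => z zc _.
have az : a != z by rewrite eq_sym.
have cUa : c \in U :\ a by rewrite !inE eq_sym ac.
apply: (@close_turn _ v0 Q D _ _ _ _ (U :\ a :\ c) 5) => //.
- exact: add_edge_sym.
- exact: low_degrees_add.
- by apply: maker_path_add => //; apply: maker_path_add.
- apply: add_edgeN; [|by rewrite eq_sym|exact: neq0].
  by rewrite /E2 /add_edge sE1 E1f // (negPf (neqy _ cU')) (eq_sym c) (negPf ac).
- exact: UQ'.
- exact: disjointWl (subsetDl _ _) (subQ a).
- by rewrite (card_setD1 cUa (cU a aU)).
by rewrite (card_setD1 cUa (cU a aU)).
Qed.

End Phases.

(** * Degree counting and the start of the game *)

Section Opening.

Variable T : finType.
Implicit Types (E : rel T) (U : {set T}).
Hypothesis large : 20 * 800 <= #|T|.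

(** At most [#|T| + 6] rounds are played in all, each adding at most 2 to the degree sum; [k] of
    them are still to come. *)
Definition few_edges E k := \sum_x deg E x + 2 * k <= 2 * (#|T| + 6).

Lemma few_edges_add E x y k : x != y -> few_edges E k.+1 -> few_edges (add_edge E x y) k.
Proof. by rewrite /few_edges; have := sum_deg_add_edge E x y; lia. Qed.

(** With 200 unvisited vertices, [200 + 7] rounds remain. Eighteen vertices of degree at least
    [#|T| %/ 8 - 206] would force a degree sum of about 9/4 of [#|T|], too much for [few_edges] when
    [#|T|] is at least 16000. *)
Lemma few_high_degrees E : few_edges E 207 ->
  #|[set x | #|T| %/ 8 < deg E x + 207]| <= 17.
Proof.
set Q := [set x | _]; set D := #|T| %/ 8 => fewE.

have : #|Q| * (D - 206) <= \sum_x deg E x.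
  rewrite -sum_nat_const; apply: (@leq_trans (\sum_(x in Q) deg E x)).
    by apply: leq_sum => x; rewrite inE -/D; clear; lia.
  by rewrite [leqRHS](bigID (mem Q)) leq_addr.
have [//|cQ lesum] := leqP #|Q| 17.
have : 18 * (D - 206) <= #|Q| * (D - 206) by rewrite leq_mul2r cQ orbT.
move: lesum fewE large; rewrite /few_edges; have := leq_divM #|T| 8.
have := ltn_ceil #|T| (isT : 0 < 8); rewrite -/D.
move: (#|Q| * _) (\sum_x _) => q S; clearbody D; clear; lia.
Qed.

Lemma final_phase v0 E (v b : T) U h :
  hot v0 E v b U h -> #|U| = 200 -> winning v0 few_edges E v b U.
Proof.
move=> Hh U200 M pM; rewrite U200 => fewE.
(* [7 * D] is at most 7/8 of [#|T|], which leaves room for [3 * #|Q| + 6]. *)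
pose D := #|T| %/ 8; pose Q := [set x | D < deg E x + 207].
have cQ : #|Q| <= 17 := few_high_degrees fewE.
have cT : 7 * D + 3 * #|Q| + 6 < #|T|.
  by move: cQ large; rewrite /D; clear; lia.
have lowE : low_degrees Q D E 207 by move=> x; rewrite inE -leqNgt.
have: winning v0 (low_degrees Q D) E v b U; last first.
  by move=> W; rewrite -[200]U200; apply: W => //; rewrite U200.
apply: (hunt (m := 3) (Q := Q) _ _ _ Hh) => //.
- by move=> *; apply: low_degrees_add.
- by move=> E' v' b' U' h' Hh' U3 UQ; apply: endgame cT Hh' U3 UQ.
- by rewrite U200.
(* At worst [9 + 10 * 16 + 3 = 172], within the 200 unvisited vertices. *)
move=> z zUQ; exists z => //; rewrite U200.
have : #|U :&: Q| <= 17 := leq_trans (subset_leq_card (subsetIr _ _)) cQ.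
have := delay_bounds v0 E v b U h z; clear; lia.
Qed.

(** WMaker starts off WBreaker's first edge and walks to his position [b2], so the only harmed
    unvisited vertex is [b1]. *)
Lemma opening (b1 b2 : T) : b1 != b2 ->
  exists v0, [/\ v0 != b1, v0 != b2
    & win (#|T| + 5) (add_edge (fun _ _ => false) v0 b2) b2
        (add_edge (fun _ _ => false) b1 b2) b2].
Proof.
move=> b12; set E := add_edge _ b1 b2.
have [v0] : exists v0, v0 \notin [set b1; b2].
  apply/existsP; rewrite -negb_forall; apply: contraTN large => /forallP H.
  have : #|T| <= #|[set b1; b2]|.
    by rewrite -cardsT; apply/subset_leq_card/subsetP => x _; apply: H.
  by rewrite cards2; case: (_ != _); clear; lia.
rewrite !inE negb_or => /andP[v01 v02]; exists v0; split=> //.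
pose U := [set x | x \notin [:: v0; b2]].
have cU : #|T| + 5 = #|U| + 7.
  have -> : U = ~: [set v0; b2] by apply/setP=> x; rewrite !inE.
  by move: (cardsC [set v0; b2]) large; rewrite cards2 v02; clear; lia.
have v0U : v0 \notin U by rewrite !inE eqxx.
have b2U : b2 \notin U by rewrite !inE eqxx orbT.
have neq x y : x \in U -> y \notin U -> x != y by move=> xU; apply: contraNneq => <-.
(* With nothing to hunt, the path is merely extended until 200 vertices are left. *)
rewrite cU; apply: (@hunt _ v0 few_edges few_edges_add set0 200 _ _ E b2 b2 U b1) => //.
- by move=> E' v' b' U' h' Hh' U200 _; apply: final_phase Hh' U200.
- split=> //; first exact: add_edge_sym.
  + by rewrite eq_sym.
  + move=> x y xU yU; rewrite /E /add_edge /=.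
    by rewrite (negPf (neq _ _ xU b2U)) (negPf (neq _ _ yU b2U)) !andbF.
  + move=> x xU xh; rewrite /E /add_edge /= (negPf xh) (negPf v01) (negPf v02).
    by rewrite (negPf (neq _ _ xU b2U)) !andbF.
  + by move=> _; rewrite /E /add_edge /= (negPf v01) (negPf v02) !andbF.
- by move: cU large; clear; lia.
- by move=> z; rewrite setI0 inE.
- exists [:: b2]; split=> //=; first by rewrite add_edgel.
  by rewrite inE v02.
rewrite -cU /few_edges /E.
have deg0 : \sum_x deg (fun _ _ : T => false) x = 0.
  by apply: big1 => x _; apply: eq_card0 => y; rewrite inE.
have := sum_deg_add_edge (fun _ _ => false) b1 b2; rewrite deg0.
by clear; lia.
Qed.

End Opening.

(** * From positions back to histories and strategies *)

Section Strategy.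

Variable n : nat.
Implicit Types (h : seq (round n)) (s : seq (move n)).

Definition edges s : rel 'I_n := fun x y => [set x; y] \in claimed s.

Lemma set2_eq (T : finType) (x y a b : T) :
  ([set x; y] == [set a; b]) = (x == a) && (y == b) || (x == b) && (y == a).
Proof.
apply/eqP/idP => [e|/orP[]/andP[/eqP-> /eqP->] //]; last by rewrite setUC.
have xab : x \in [set a; b] by rewrite -e set21.
have yab : y \in [set a; b] by rewrite -e set22.
have axy : a \in [set x; y] by rewrite e set21.
have bxy : b \in [set x; y] by rewrite e set22.
move: xab yab axy bxy; rewrite !in_set2 => /orP[]/eqP-> /orP[]/eqP->;
  by rewrite ?orbb => /eqP H1 /eqP H2; rewrite ?H1 ?H2 ?eqxx ?orbT //; rewrite -H1 ?eqxx.
Qed.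

Lemma edges_rcons s a b : edges (rcons s (a, b)) =2 add_edge (edges s) a b.
Proof.
by move=> x y; rewrite /edges /claimed map_rcons mem_rcons inE set2_eq /add_edge orbC.
Qed.

Fixpoint winning_history k h : Prop :=
  wmaker_won h \/
  if k is k'.+1 then
    forall b, legal (wbreaker_moves h) (wmaker_moves h) b ->
      exists e, legal (wmaker_moves h) (rcons (wbreaker_moves h) b) e /\
        winning_history k' (rcons h (b, e))
  else False.

Lemma wbreaker_moves_rcons h b e : wbreaker_moves (rcons h (b, e)) = rcons (wbreaker_moves h) b.
Proof. exact: map_rcons. Qed.

Lemma wmaker_moves_rcons h b e : wmaker_moves (rcons h (b, e)) = rcons (wmaker_moves h) e.
Proof. exact: map_rcons. Qed.

Lemma add_edge_eq (T : finType) (E E' : rel T) x y :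
  E =2 E' -> add_edge E x y =2 add_edge E' x y.
Proof. by move=> eqE a b; rewrite /add_edge eqE. Qed.

(** A position is the endpoint of the last move; as [h] is nonempty, the default [e0] is never
    reached. *)
Lemma win_winning_history k M w E b h e0 :
  M =2 edges (wmaker_moves h) -> E =2 edges (wbreaker_moves h) -> h != [::] ->
  (last e0 (wmaker_moves h)).2 = w -> (last e0 (wbreaker_moves h)).2 = b ->
  win k M w E b -> winning_history k h.
Proof.
elim: k M w E b h => [|k IH] M w E b h eqM eqE h0 lastw lastb /= [ham|W] //;
  try by left; have [c [szc /andP[cM uc] allc]] := ham; exists c; split=> //;
    rewrite /ucycle -(eq_cycle eqM) cM.
have lastE (s : seq (move n)) e : s != [::] -> last e s = last e0 s by case: s.
have mk0 : wmaker_moves h != [::] by case: (h) h0.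
have br0 : wbreaker_moves h != [::] by case: (h) h0.
right=> -[x y] /and3P[/= xy]; rewrite (negPf br0) lastE // lastb /= => /eqP xb.
rewrite xb in xy * => bN.
have yb : y != b by rewrite eq_sym.
have [u [uw Eu Wu]] := W y yb (etrans (congr1 negb (eqM b y)) bN).
exists (w, u); split.
  rewrite /legal /= eq_sym uw (negPf mk0) lastE // lastw eqxx /=.
  by move: Eu; rewrite (add_edge_eq _ _ eqE) -edges_rcons.
apply: IH Wu.
- by move=> a c; rewrite wmaker_moves_rcons edges_rcons; apply: add_edge_eq.
- by move=> a c; rewrite wbreaker_moves_rcons edges_rcons; apply: add_edge_eq.
- by case: (h).
- by rewrite wmaker_moves_rcons last_rcons.
- by rewrite wbreaker_moves_rcons last_rcons.
Qed.

(** Any legal answer that keeps the history winning with one move fewer will do; [b] only shows that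
    moves exist. *)
Definition strategy_of N : strategy n := fun h b =>
  epsilon (inhabits b) (fun e =>
    legal (wmaker_moves h) (rcons (wbreaker_moves h) b) e /\
    winning_history (N - size h).-1 (rcons h (b, e))).

Lemma strategy_of_wins N : winning_history N [::] -> wins_within (strategy_of N) N.
Proof.
move=> W.
have inv h : play (strategy_of N) h -> size h <= N /\ winning_history (N - size h) h.
  elim=> [|{}h b _ [szh Wh] nwon lb]; first by rewrite subn0.
  case Nh: (N - size h) Wh => [|k] /= []// /(_ b lb).
  move/(epsilon_spec (inhabits b)).
  rewrite size_rcons subnS /strategy_of Nh => -[_ H]; split=> //.
  by rewrite -subn_gt0 Nh.
move=> h /inv[szh]; case Nh: (N - size h) => [|k] /= []// H _.
split; first by rewrite -subn_gt0 Nh.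
move=> b /H /(epsilon_spec (inhabits b)).
by rewrite /strategy_of Nh => -[].
Qed.

End Strategy.

Theorem theorem2 :
  exists n0 : nat, forall n : nat, n0 <= n ->
    exists sigma : strategy n, wins_within sigma (n + 6).
Proof.
exists (20 * 800) => n large.
exists (strategy_of (n + 6)); apply: strategy_of_wins.
have largeT : 20 * 800 <= #|'I_n| by rewrite card_ord.
(* The first round is treated apart, since before it the players have no positions; [n + 5] moves
   remain after it. *)
rewrite addnS; right=> -[b1 b2] /andP[/= b12 _].
have [v0 [v01 v02]] := opening largeT b12.
rewrite card_ord => W; exists (v0, b2); split.
  rewrite /legal /= v02 /claimed /= inE set2_eq (negPf v01) (negPf v02).
  by [].
apply: win_winning_history (v0, v0) _ _ _ _ _ W => // x y.
  by rewrite /edges /claimed /= inE set2_eq.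
by rewrite /edges /claimed /= inE set2_eq.
Qed.
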